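(* Let $M,N\in\operatorname{rep}(Q)$, let $0\neq e\in R(N,M)$, and let $U_{N,M}\subseteq R(N,M)$, $U_M\subseteq R(M,M)$, $U_N\subseteq R(N,N)$ be subsets. Assume that $U_M$ and $U_N$ are both strong (that is, $M(\lambda)$ is indecomposable for all $\lambda\in U_M$ and $N(\mu)$ is indecomposable for all $\mu\in U_N$), and let $W\subseteq U_{N,M}\times U_M\times U_N$ be a subset such that (i) $\pi_{N(\mu),M(\lambda)}(e+\tau)\neq 0$ in $\operatorname{Ext}(N(\mu),M(\lambda))$ for all $(\tau,\lambda,\mu)\in W$; (ii) $\Theta_{e+\tau,\lambda,\mu}^{e+\tau,\lambda,\mu}=0$ for all $(\tau,\lambda,\mu)\in W$. Then the representation $B(e+\tau,\lambda,\mu)$ is indecomposable for every $(\tau,\lambda,\mu)\in W$.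
   Context: Fix a quiver $Q$ (vertices $Q_0$, arrows $Q_1$, source and target maps $s,t$) and an arbitrary field $\Bbbk$; $\operatorname{rep}(Q)$ is the category of finite-dimensional $\Bbbk$-representations, $\operatorname{Hom}$ is taken in $\operatorname{rep}(Q)$ and $\operatorname{Ext}=\operatorname{Ext}^1_{\operatorname{rep}(Q)}$. For $M,N\in\operatorname{rep}(Q)$ put $R(N,M)=\bigoplus_{a\in Q_1}\operatorname{Hom}_\Bbbk(N_{s(a)},M_{t(a)})$. The surjection $\pi_{N,M}:R(N,M)\to\operatorname{Ext}(N,M)$ sends $f=(f_a)_a$ to the class of $0\to M\to B(f)\to N\to 0$ with $B(f)_q=M_q\oplus N_q$, $B(f)_a=\begin{pmatrix}M_a&f_a\\0&N_a\end{pmatrix}$. For $\lambda\in R(M,M)$ let $M(\lambda)=M+\lambda$ be the representation with the same vector spaces and maps $M_a+\lambda_a$. Note $R(N(\mu),M(\lambda))=R(N,M)$ as vector spaces. For $(\tau,\lambda,\mu)\in R(N,M)\times R(M,M)\times R(N,N)$ let $B(\tau,\lambda,\mu)$ be the representation with $B(\tau,\lambda,\mu)_q=M_q\oplus N_q$ and $B(\tau,\lambda,\mu)_a=\begin{pmatrix}M(\lambda)_a&\tau_a\\0&N(\mu)_a\end{pmatrix}$; it is the middle term of $\pi_{N(\mu),M(\lambda)}(\tau)$: $0\to M(\lambda)\to B(\tau,\lambda,\mu)\to N(\mu)\to0$. The linear map $\Theta_{e+\tau,\lambda,\mu}^{e+\tau',\lambda',\mu'}:\operatorname{Hom}(B(e+\tau,\lambda,\mu),B(e+\tau',\lambda',\mu'))\to\operatorname{Hom}(M(\lambda),N(\mu'))$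 sends $\phi$ to the composition of the inclusion $M(\lambda)\hookrightarrow B(e+\tau,\lambda,\mu)$, $\phi$, and the surjection $B(e+\tau',\lambda',\mu')\twoheadrightarrow N(\mu')$. *)

(* Defs.v *)
From HB Require Import structures.
From mathcomp Require Import all_boot all_algebra.
From mathcomp Require Import boolp classical_sets functions cardinality.

Set Implicit Arguments.
Unset Strict Implicit.
Unset Printing Implicit Defensive.

Import GRing.Theory.
Local Open Scope ring_scope.
Local Open Scope classical_set_scope.
Local Open Scope lfun_scope.

(* Vertex and arrow sets are arbitrary: loops, oriented cycles, multiple
   arrows and infinite quivers are all allowed. *)
Record quiver := Quiver {
  vertex : Type;
  arrow : Type;
  src : arrow -> vertex;
  tgt : arrow -> vertex }.

(* Finite-dimensional means finite total dimension: every vertex space is a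
   [vectType] and only finitely many of them are nonzero. *)
Record rep (k : fieldType) (Q : quiver) := Rep {
  rspace :> vertex Q -> vectType k;
  rmap : forall a : arrow Q, 'Hom(rspace (src a), rspace (tgt a));
  rep_finite : finite_set [set q | \dim {: rspace q} != 0%N] }.

Record rep_hom (k : fieldType) (Q : quiver) (M N : rep k Q) := MkHom {
  hom_fun :> forall q : vertex Q, 'Hom(M q, N q);
  hom_comm : forall a : arrow Q,
    (hom_fun (tgt a) \o rmap M a = rmap N a \o hom_fun (src a))%VF }.

Lemma hom_eqP (k : fieldType) (Q : quiver) (M N : rep k Q) (f g : rep_hom M N) :
  (forall q, f q = g q) -> f = g.
Proof.
case: f g => [f fc] [g gc] /= fg.
have E : f = g by apply: functional_extensionality_dep.
by subst g; rewrite (Prop_irrelevance fc gc).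
Qed.

Definition hom_id (k : fieldType) (Q : quiver) (M : rep k Q) : rep_hom M M.
Proof.
exists (fun q => \1%VF).
abstract (by move=> a; rewrite comp_lfun1l comp_lfun1r).
Defined.

Definition hom_zero (k : fieldType) (Q : quiver) (M N : rep k Q) : rep_hom M N.
Proof.
exists (fun q => 0).
abstract (by move=> a; rewrite comp_lfun0l comp_lfun0r).
Defined.

Definition hom_comp (k : fieldType) (Q : quiver) (L M N : rep k Q)
  (g : rep_hom M N) (f : rep_hom L M) : rep_hom L N.
Proof.
exists (fun q => (g q \o f q)%VF).
abstract (by move=> a;
  rewrite -comp_lfunA (hom_comm f) comp_lfunA (hom_comm g) comp_lfunA).
Defined.

Definition rep_iso (k : fieldType) (Q : quiver) (M N : rep k Q) : Prop :=
  exists (f : rep_hom M N) (g : rep_hom N M),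
    hom_comp g f = hom_id M /\ hom_comp f g = hom_id N.

Definition is_zero_rep (k : fieldType) (Q : quiver) (M : rep k Q) : Prop :=
  forall q, \dim {: M q} = 0%N.

(* The direct sum R(N, M) as finitely supported families.  It only depends on
   the vertex spaces of N and M, so that R(N(mu), M(lambda)) and R(N, M) are
   convertible. *)
Record Rsp (k : fieldType) (Q : quiver) (N M : vertex Q -> vectType k) :=
  MkRsp {
    Rsp_fun :> forall a : arrow Q, 'Hom(N (src a), M (tgt a));
    Rsp_finite : finite_set [set a | Rsp_fun a != 0] }.

Section RspZmodule.
Variables (k : fieldType) (Q : quiver) (N M : vertex Q -> vectType k).
Implicit Types f g h : Rsp N M.

Lemma Rsp_eqP f g : (forall a, f a = g a) -> f = g.
Proof.
case: f g => [f fc] [g gc] /= fg.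
have E : f = g by apply: functional_extensionality_dep.
by subst g; rewrite (Prop_irrelevance fc gc).
Qed.

Definition Rsp_zero : Rsp N M.
Proof.
exists (fun a => 0).
abstract (by apply: (sub_finite_set _ (@finite_set0 _)) => a /=; rewrite eqxx).
Defined.

Definition Rsp_opp f : Rsp N M.
Proof.
exists (fun a => - f a).
abstract (by apply: (sub_finite_set _ (@Rsp_finite _ _ _ _ f)) => a /=;
  rewrite oppr_eq0).
Defined.

Definition Rsp_add f g : Rsp N M.
Proof.
exists (fun a => f a + g a).
abstract (apply: (@sub_finite_set _ _
    ([set a | f a != 0] `|` [set a | g a != 0]));
  [ by move=> a /=; have [->|] := eqVneq (f a) 0;
      [rewrite add0r; right | left]
  | by rewrite finite_setU; split; apply: Rsp_finite ]).
Defined.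

HB.instance Definition _ := gen_eqMixin (Rsp N M).
HB.instance Definition _ := gen_choiceMixin (Rsp N M).

Lemma Rsp_addA : associative Rsp_add.
Proof. by move=> f g h; apply: Rsp_eqP => a; apply: addrA. Qed.

Lemma Rsp_addC : commutative Rsp_add.
Proof. by move=> f g; apply: Rsp_eqP => a; apply: addrC. Qed.

Lemma Rsp_add0 : left_id Rsp_zero Rsp_add.
Proof. by move=> f; apply: Rsp_eqP => a; apply: add0r. Qed.

Lemma Rsp_addN : left_inverse Rsp_zero Rsp_opp Rsp_add.
Proof. by move=> f; apply: Rsp_eqP => a; apply: addNr. Qed.

HB.instance Definition _ :=
  GRing.isZmodule.Build (Rsp N M) Rsp_addA Rsp_addC Rsp_add0 Rsp_addN.

End RspZmodule.

Definition rep_shift (k : fieldType) (Q : quiver) (M : rep k Q)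
  (lambda : Rsp M M) : rep k Q :=
  Rep (fun a => rmap M a + lambda a) (rep_finite M).

Section Blocks.
Variables (k : fieldType) (M N M' N' : vectType k).
Variables (f : 'Hom(M, M')) (e : 'Hom(N, M')) (g : 'Hom(N, N')).

Let block_fun (z : M * N) : M' * N' := (f z.1 + e z.2, g z.2).

Definition block_lfun : 'Hom((M * N)%type, (M' * N')%type) :=
  linfun block_fun.

Lemma block_lfunE (z : M * N) :
  block_lfun z = (f z.1 + e z.2, g z.2).
Proof.
have lin : linear block_fun.
  move=> c [x y] [x' y']; rewrite /block_fun /= !linearP.
  by rewrite addrACA -scalerDr.
pose mx := GRing.isLinear.Build _ _ _ _ block_fun lin.
pose F : {linear (M * N)%type -> (M' * N')%type} := HB.pack block_fun mx.
exact: (lfunE F).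
Qed.

End Blocks.

Section Pairs.
Variables (k : fieldType) (M N : vectType k).

Definition inl_lfun : 'Hom(M, (M * N)%type) := linfun (fun x => (x, 0)).

Definition snd_lfun : 'Hom((M * N)%type, N) := linfun snd.

Lemma inl_lfunE (x : M) : inl_lfun x = (x, 0).
Proof.
have lin : linear (fun x : M => (x, 0 : N)).
  move=> c y z; rewrite -[X in (_, X)](addr0 0) -[X in (_, X + _)](scaler0 _ c).
  by [].
pose mx := GRing.isLinear.Build _ _ _ _ (fun x : M => (x, 0 : N)) lin.
pose F : {linear M -> (M * N)%type} := HB.pack (fun x : M => (x, 0 : N)) mx.
exact: (lfunE F).
Qed.

Lemma snd_lfunE (z : M * N) : snd_lfun z = z.2.
Proof. exact: lfunE. Qed.

End Pairs.

Lemma dim_pair_finite (k : fieldType) (Q : quiver) (M N : rep k Q) :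
  finite_set [set q | \dim {: (M q * N q)%type} != 0%N].
Proof.
apply: (@sub_finite_set _ _
  ([set q | \dim {: M q} != 0%N] `|` [set q | \dim {: N q} != 0%N])).
  move=> q /=; rewrite !dimvf /= => MN.
  have [M0|] := eqVneq (dim (M q)) 0%N; last by left.
  right; apply: contra MN => /eqP N0.
  by rewrite [X in X == _](_ : _ = (dim (M q) + dim (N q))%N) // M0 N0.
by rewrite finite_setU; split; apply: rep_finite.
Qed.

(* The middle term B(f) of pi_{N,M}(f). *)
Definition mid_rep (k : fieldType) (Q : quiver) (N M : rep k Q) (f : Rsp N M) :
  rep k Q :=
  @Rep k Q (fun q => (M q * N q)%type)
    (fun a => block_lfun (rmap M a) (f a) (rmap N a)) (dim_pair_finite M N).

Definition mid_inj (k : fieldType) (Q : quiver) (N M : rep k Q) (f : Rsp N M) :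
  rep_hom M (mid_rep f).
Proof.
exists (fun q => inl_lfun (M q) (N q)).
abstract (by move=> a; apply/lfunP => x;
  rewrite !comp_lfunE block_lfunE !inl_lfunE /= !linear0 addr0).
Defined.

Definition mid_proj (k : fieldType) (Q : quiver) (N M : rep k Q) (f : Rsp N M) :
  rep_hom (mid_rep f) N.
Proof.
exists (fun q => snd_lfun (M q) (N q)).
abstract (by move=> a; apply/lfunP => x;
  rewrite !comp_lfunE block_lfunE !snd_lfunE).
Defined.

Definition rep_sum (k : fieldType) (Q : quiver) (M N : rep k Q) : rep k Q :=
  @Rep k Q (fun q => (M q * N q)%type)
    (fun a => block_lfun (rmap M a) 0 (rmap N a)) (dim_pair_finite M N).

Definition indecomposable (k : fieldType) (Q : quiver) (M : rep k Q) : Prop :=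
  ~ is_zero_rep M /\
  forall X Y : rep k Q,
    rep_iso M (rep_sum X Y) -> is_zero_rep X \/ is_zero_rep Y.

Definition strong (k : fieldType) (Q : quiver) (M : rep k Q)
  (U : set (Rsp M M)) : Prop :=
  forall lambda, U lambda -> indecomposable (rep_shift lambda).

Definition short_exact (k : fieldType) (Q : quiver) (M E N : rep k Q)
  (i : rep_hom M E) (p : rep_hom E N) : Prop :=
  forall q, [/\ lker (i q) = 0%VS, limg (i q) = lker (p q)
              & limg (p q) = fullv].

(* Extensions 0 -> M -> E -> N -> 0 in rep(Q). *)
Record extension (k : fieldType) (Q : quiver) (N M : rep k Q) := Extension {
  ext_mid : rep k Q;
  ext_inj : rep_hom M ext_mid;
  ext_proj : rep_hom ext_mid N;
  ext_exact : short_exact ext_inj ext_proj }.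

Definition ext_equiv (k : fieldType) (Q : quiver) (N M : rep k Q)
  (E E' : extension N M) : Prop :=
  exists phi : rep_hom (ext_mid E) (ext_mid E'),
    hom_comp phi (ext_inj E) = ext_inj E' /\
    hom_comp (ext_proj E') phi = ext_proj E.

(* Yoneda Ext^1 in rep(Q): an element is an equivalence class of extensions.
   The class is a bare predicate because [set] would cause a universe
   inconsistency on the large type [extension N M]. *)
Record Ext (k : fieldType) (Q : quiver) (N M : rep k Q) := MkExt {
  Ext_mem : extension N M -> Prop;
  Ext_is_class : exists E, Ext_mem = ext_equiv E }.

Definition ext_class (k : fieldType) (Q : quiver) (N M : rep k Q)
  (E : extension N M) : Ext N M :=
  MkExt (ex_intro (fun E' => ext_equiv E = ext_equiv E') E erefl).

Lemma mid_exact (k : fieldType) (Q : quiver) (N M : rep k Q) (f : Rsp N M) :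
  short_exact (mid_inj f) (mid_proj f).
Proof.
move=> q /=; split.
- apply/eqP/lker0P => x y; rewrite !inl_lfunE; by case.
- apply/vspaceP => z; rewrite memv_ker snd_lfunE; apply/memv_imgP/eqP.
    by case=> x _ ->; rewrite inl_lfunE.
  case: z => x y /= ->; exists x; first exact: memvf.
  by rewrite inl_lfunE.
- apply/vspaceP => y; rewrite memvf; apply/memv_imgP.
  by exists (0, y); rewrite ?memvf // snd_lfunE.
Qed.

Definition pi_ext (k : fieldType) (Q : quiver) (N M : rep k Q) (f : Rsp N M) :
  Ext N M := ext_class (Extension (mid_exact f)).

Definition sum_inj (k : fieldType) (Q : quiver) (M N : rep k Q) :
  rep_hom M (rep_sum M N).
Proof.
exists (fun q => inl_lfun (M q) (N q)).
abstract (by move=> a; apply/lfunP => x;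
  rewrite !comp_lfunE block_lfunE !inl_lfunE /= !linear0 addr0).
Defined.

Definition sum_proj (k : fieldType) (Q : quiver) (M N : rep k Q) :
  rep_hom (rep_sum M N) N.
Proof.
exists (fun q => snd_lfun (M q) (N q)).
abstract (by move=> a; apply/lfunP => x;
  rewrite !comp_lfunE block_lfunE !snd_lfunE).
Defined.

Lemma sum_exact (k : fieldType) (Q : quiver) (M N : rep k Q) :
  short_exact (sum_inj M N) (sum_proj M N).
Proof. exact: (mid_exact (0 : Rsp N M)). Qed.

(* The zero of Ext(N, M) for the Baer sum: the class of the split extension
   0 -> M -> M (+) N -> N -> 0. *)
Definition Ext_zero (k : fieldType) (Q : quiver) (N M : rep k Q) : Ext N M :=
  ext_class (Extension (sum_exact M N)).

(* pi_{N(mu), M(lambda)}(f), for f in R(N(mu), M(lambda)) = R(N, M). *)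
Definition pi_shift (k : fieldType) (Q : quiver) (N M : rep k Q)
  (f : Rsp N M) (lambda : Rsp M M) (mu : Rsp N N) :
  Ext (rep_shift mu) (rep_shift lambda) :=
  @pi_ext k Q (rep_shift mu) (rep_shift lambda) f.

Definition Brep (k : fieldType) (Q : quiver) (N M : rep k Q)
  (tau : Rsp N M) (lambda : Rsp M M) (mu : Rsp N N) : rep k Q :=
  @mid_rep k Q (rep_shift mu) (rep_shift lambda) tau.

Definition Theta (k : fieldType) (Q : quiver) (N M : rep k Q)
  (tau : Rsp N M) (lambda : Rsp M M) (mu : Rsp N N)
  (tau' : Rsp N M) (lambda' : Rsp M M) (mu' : Rsp N N)
  (phi : rep_hom (Brep tau lambda mu) (Brep tau' lambda' mu')) :
  rep_hom (rep_shift lambda) (rep_shift mu') :=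
  hom_comp (@mid_proj k Q (rep_shift mu') (rep_shift lambda') tau')
    (hom_comp phi (@mid_inj k Q (rep_shift mu) (rep_shift lambda) tau)).

(* Main.v *)
Require Import Defs.
From HB Require Import structures.
From mathcomp Require Import all_boot all_algebra.
From mathcomp Require Import boolp classical_sets functions cardinality.

Import GRing.Theory.
Local Open Scope ring_scope.
Local Open Scope classical_set_scope.

(* A decomposition of B = B(e + tau, lambda, mu) is an idempotent endomorphism
   phi of B.  As Theta vanishes, phi preserves M = M(lambda), and so induces
   idempotents of M and of N = N(mu), each of which is 0 or 1 because M and N
   are indecomposable.  If both are 0, then phi maps B into M and kills M, so
   phi = phi^2 = 0; if both are 1, the same applies to 1 - phi.  Otherwise phi
   or 1 - phi is a retraction of B onto M, and the extension splits. *)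

(** * Linear maps into and out of a product of spaces *)

Section PairLfun.
Context {k : fieldType} {V A B : vectType k} (f : 'Hom(V, A)) (g : 'Hom(V, B)).

Let pair_fun (x : V) : A * B := (f x, g x).

Definition pair_lfun : 'Hom(V, (A * B)%type) := linfun pair_fun.

Lemma pair_lfunE x : pair_lfun x = (f x, g x).
Proof.
have lin : linear pair_fun by move=> c y z; rewrite /pair_fun !linearP.
pose mx := GRing.isLinear.Build _ _ _ _ pair_fun lin.
pose F : {linear V -> (A * B)%type} := HB.pack pair_fun mx.
exact: (lfunE F).
Qed.

End PairLfun.

Definition fst_lfun {k : fieldType} (A B : vectType k) : 'Hom((A * B)%type, A) :=
  linfun fst.

Lemma fst_lfunE (k : fieldType) (A B : vectType k) (z : A * B) :
  fst_lfun A B z = z.1.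
Proof. exact: lfunE. Qed.

Definition copair_lfun {k : fieldType} {A B V : vectType k}
    (f : 'Hom(A, V)) (g : 'Hom(B, V)) : 'Hom((A * B)%type, V) :=
  ((f \o fst_lfun A B) + (g \o snd_lfun A B))%VF.

Lemma copair_lfunE {k : fieldType} {A B V : vectType k}
    (f : 'Hom(A, V)) (g : 'Hom(B, V)) x y :
  copair_lfun f g (x, y) = f x + g y.
Proof. by rewrite add_lfunE !comp_lfunE fst_lfunE snd_lfunE. Qed.

Lemma dimv_eq0P (k : fieldType) (V : vectType k) :
  \dim {: V} = 0%N <-> forall x : V, x = 0.
Proof.
split=> [/eqP | V0].
  by rewrite dimv_eq0 => /eqP V0 x; apply/eqP; rewrite -memv0 -V0 memvf.
apply/eqP; rewrite dimv_eq0; apply/eqP/vspaceP => x.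
by rewrite memvf memv0 (V0 x) eqxx.
Qed.

Section Representations.
Context {k : fieldType} {Q : quiver}.

Lemma hom_commE {M N : rep k Q} (phi : rep_hom M N) a x :
  phi _ (rmap M a x) = rmap N a (phi _ x).
Proof. by have /lfunP/(_ x) := hom_comm phi a; rewrite !comp_lfunE. Qed.

Lemma hom_addE {M N : rep k Q} (phi : rep_hom M N) q x y :
  phi q (x + y) = phi q x + phi q y.
Proof. exact: linearD. Qed.

Lemma hom_ext {M N : rep k Q} (phi psi : rep_hom M N) :
  (forall q x, phi q x = psi q x) -> phi = psi.
Proof. by move=> E; apply: hom_eqP => q; apply/lfunP => x; apply: E. Qed.

Lemma rep_sum_mapE (M N : rep k Q) a x y :
  rmap (rep_sum M N) a (x, y) = (rmap M a x, rmap N a y).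
Proof. by rewrite block_lfunE zero_lfunE addr0. Qed.

Lemma mid_rep_mapE {M N : rep k Q} (f : Rsp N M) a x y :
  rmap (mid_rep f) a (x, y) = (rmap M a x + f a y, rmap N a y).
Proof. by rewrite block_lfunE. Qed.

Definition sum_pair {L M N : rep k Q} (f : rep_hom L M) (g : rep_hom L N) :
  rep_hom L (rep_sum M N).
Proof.
exists (fun q => pair_lfun (f q) (g q)).
abstract (by move=> a; apply/lfunP => x; rewrite [LHS]comp_lfunE [RHS]comp_lfunE
  !pair_lfunE rep_sum_mapE !hom_commE).
Defined.

Definition sum_copair {L M N : rep k Q} (f : rep_hom M L) (g : rep_hom N L) :
  rep_hom (rep_sum M N) L.
Proof.
exists (fun q => copair_lfun (f q) (g q)).
abstract (move=> a; apply/lfunP => -[x y];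
  by rewrite [LHS]comp_lfunE [RHS]comp_lfunE rep_sum_mapE !copair_lfunE
    !hom_commE linearD).
Defined.

(** * Idempotent endomorphisms and direct sum decompositions *)

Definition idempotent_hom {M : rep k Q} (phi : rep_hom M M) : Prop :=
  forall q x, phi q (phi q x) = phi q x.

Definition hom_compl {M : rep k Q} (phi : rep_hom M M) : rep_hom M M.
Proof.
exists (fun q => \1%VF - phi q).
abstract (by move=> a; apply/lfunP => x;
  rewrite !(comp_lfunE, add_lfunE, opp_lfunE, id_lfunE) linearB /= hom_commE).
Defined.

Lemma hom_complE {M : rep k Q} (phi : rep_hom M M) q x :
  hom_compl phi q x = x - phi q x.
Proof. by rewrite !(add_lfunE, opp_lfunE, id_lfunE). Qed.

Lemma hom_compl_idem {M : rep k Q} {phi : rep_hom M M} :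
  idempotent_hom phi -> idempotent_hom (hom_compl phi).
Proof.
by move=> idem q x; rewrite !hom_complE linearB /= idem subrr subr0.
Qed.

Section Image.
Context {M : rep k Q} (phi : rep_hom M M).

Lemma image_rep_finite :
  finite_set [set q | \dim {: subvs_of (limg (phi q))} != 0%N].
Proof.
apply: sub_finite_set (rep_finite M) => q /=; apply: contra => /eqP/dimv_eq0P M0.
by apply/eqP/dimv_eq0P => x; apply: val_inj; rewrite (M0 (val x)) linear0.
Qed.

(** Since [phi] commutes with the arrow maps of [M], these preserve its image, so [vsproj] is
    applied only to vectors already in the image. *)
Definition image_rep : rep k Q :=
  @Rep k Q (fun q => subvs_of (limg (phi q)))
    (fun a => linfun (vsproj (limg (phi (tgt a)))) \o rmap M a \o linfun vsval)%VF
    image_rep_finite.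

Lemma image_rep_mapE a x : vsval (rmap image_rep a x) = rmap M a (vsval x).
Proof.
rewrite /= !comp_lfunE !lfunE /= vsprojK //.
have /memv_imgP[y _ ->] := subvsP x.
by rewrite -hom_commE memv_img ?memvf.
Qed.

Definition image_incl : rep_hom image_rep M.
Proof.
exists (fun q => linfun vsval).
abstract (move=> a; apply/lfunP => x; rewrite [LHS]comp_lfunE
    [RHS]comp_lfunE [LHS]lfunE [X in _ = _ X]lfunE;
  exact: image_rep_mapE).
Defined.

Lemma image_inclE q x : image_incl q x = vsval x.
Proof. by rewrite lfunE. Qed.

Lemma image_coproj_subproof q x :
  vsval ((linfun (vsproj (limg (phi q))) \o phi q)%VF x) = phi q x.
Proof. by rewrite comp_lfunE lfunE /= vsprojK // memv_img ?memvf. Qed.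

Definition image_coproj : rep_hom M image_rep.
Proof.
exists (fun q => linfun (vsproj (limg (phi q))) \o phi q)%VF.
abstract (by move=> a; apply/lfunP => x; apply: val_inj;
  rewrite [in RHS]comp_lfunE [in LHS]comp_lfunE [LHS]image_coproj_subproof
    [RHS]image_rep_mapE image_coproj_subproof hom_commE).
Defined.

Lemma image_coprojK q x : image_incl q (image_coproj q x) = phi q x.
Proof. by rewrite image_inclE image_coproj_subproof. Qed.

Lemma image_incl_inj q : injective (image_incl q).
Proof. by move=> x y; rewrite !image_inclE => /val_inj. Qed.

Lemma image_fixed q x :
  idempotent_hom phi -> phi q (image_incl q x) = image_incl q x.
Proof.
by move=> idem; rewrite image_inclE; have /memv_imgP[y _ ->] := subvsP x.
Qed.

Lemma image_zero : is_zero_rep image_rep -> forall q x, phi q x = 0.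
Proof.
move=> im0 q x; rewrite -image_coprojK.
by have /dimv_eq0P/(_ (image_coproj q x)) -> := im0 q; rewrite linear0.
Qed.

End Image.

(** The corestrictions of [phi] and [1 - phi] to their images, paired, are inverse to the sum of the
    two inclusions: [phi] and [1 - phi] add up to 1 and annihilate each other. *)
Lemma idempotent_split {M : rep k Q} {phi : rep_hom M M} :
  idempotent_hom phi ->
  rep_iso M (rep_sum (image_rep phi) (image_rep (hom_compl phi))).
Proof.
move=> idem; have idem' := hom_compl_idem idem.
set psi := hom_compl phi.
(* A vector in the image of [psi] is fixed by [psi], and [phi (1 - phi) = 0]. *)
have phi_psi q x : phi q (image_incl psi q x) = 0.
  rewrite -[image_incl psi q x]image_fixed // hom_complE.
  by rewrite linearB /= idem subrr.
have psi_phi q x : psi q (image_incl phi q x) = 0.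
  by rewrite hom_complE image_fixed // subrr.
exists (sum_pair (image_coproj phi) (image_coproj psi)),
  (sum_copair (image_incl phi) (image_incl psi)); split; apply: hom_ext => q.
  move=> x; rewrite comp_lfunE id_lfunE pair_lfunE copair_lfunE !image_coprojK.
  by rewrite hom_complE addrC subrK.
move=> [x y]; rewrite comp_lfunE id_lfunE copair_lfunE pair_lfunE.
congr pair; apply: image_incl_inj; rewrite image_coprojK hom_addE.
  by rewrite image_fixed // phi_psi addr0.
by rewrite psi_phi image_fixed // add0r.
Qed.

(** One of the images of [phi] and [1 - phi] must vanish. *)
Lemma indecomposable_idempotent {M : rep k Q} {phi : rep_hom M M} :
  indecomposable M -> idempotent_hom phi ->
  (forall q x, phi q x = 0) \/ (forall q x, phi q x = x).
Proof.
move=> [_ indec] /idempotent_split/indec[/image_zero|/image_zero phi1].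
  by left.
by right=> q x; apply/esym/eqP; rewrite -subr_eq0 -hom_complE phi1.
Qed.

(** An isomorphism of [M] with a direct sum of [X] and [Y] carries the projection onto [X] to an
    idempotent of [M]; if it is 0 then [X] vanishes, if it is 1 then [Y] does. *)
Lemma indecomposable_of_idempotents {M : rep k Q} :
  ~ is_zero_rep M ->
  (forall phi : rep_hom M M, idempotent_hom phi ->
     (forall q x, phi q x = 0) \/ (forall q x, phi q x = x)) ->
  indecomposable M.
Proof.
move=> M0 idem01; split=> // X Y [f [g [gf fg]]].
have fgE q z : f q (g q z) = z.
  by have := congr1 (fun h : rep_hom _ _ => h q z) fg; rewrite comp_lfunE id_lfunE.
pose p := sum_copair (sum_inj X Y) (hom_zero Y (rep_sum X Y)).
have pE q z : p q z = (z.1, 0).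
  by case: z => x y; rewrite copair_lfunE inl_lfunE zero_lfunE addr0.
have eE q x : hom_comp g (hom_comp p f) q x = g q ((f q x).1, 0).
  by rewrite !comp_lfunE pE.
have idem : idempotent_hom (hom_comp g (hom_comp p f)).
  by move=> q x; rewrite !eE fgE.
(* The test vectors correspond to [(x, 0)], which the projection fixes, and to [(0, x)], which it
   kills. *)
have [e0|e1] := idem01 _ idem; [left|right] => q; apply/dimv_eq0P => x.
  have := e0 q (g q (x, 0)); rewrite eE fgE => /(congr1 (f q)).
  by rewrite fgE linear0 => -[].
have := e1 q (g q (0, x)); rewrite eE fgE => /(congr1 (f q)).
by rewrite !fgE => -[].
Qed.

(** * Equality of extension classes and splitting *)

Lemma ext_equiv_trans {M N : rep k Q} {E1 E2 E3 : extension N M} :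
  ext_equiv E1 E2 -> ext_equiv E2 E3 -> ext_equiv E1 E3.
Proof.
move=> [u [ui up]] [v [vi vp]]; exists (hom_comp v u).
split; [rewrite -vi -ui|rewrite -up -vp]; apply: hom_ext => q x;
  by rewrite !comp_lfunE.
Qed.

Lemma ext_class_eq {M N : rep k Q} (E E' : extension N M) :
  ext_equiv E E' -> ext_equiv E' E -> ext_class E = ext_class E'.
Proof.
move=> EE' E'E; rewrite /ext_class.
have equivE : ext_equiv E = ext_equiv E'.
  apply/funext => F; apply/propext.
  by split; apply: ext_equiv_trans.
(* The types of the two membership proofs mention the predicates, so the proofs are generalized
   before rewriting and then identified by proof irrelevance. *)
move: (ex_intro _ E _) (ex_intro _ E' _); rewrite equivE => p p'.
by rewrite (Prop_irrelevance p p').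
Qed.

Section MiddleTerm.
Context {M N : rep k Q} (f : Rsp N M).

(** The hypothesis says that [f] is the coboundary [M_a h - h N_a]. The shear
    [(x, y) -> (x + h y, y)] then maps the extension to the split one, and the shear by [- h] maps
    it back. *)
Lemma mid_split (h : forall q, 'Hom(N q, M q)) :
  (forall a x, rmap M a (h _ x) = f a x + h _ (rmap N a x)) ->
  pi_ext f = Ext_zero N M.
Proof.
move=> hE.
have shearE q (g : 'Hom(N q, M q)) x y :
    block_lfun \1 g \1 (x, y) = (x + g y, y).
  by rewrite block_lfunE !id_lfunE.
apply: ext_class_eq.
- have ucomm a : (block_lfun \1 (h (tgt a)) \1 \o rmap (mid_rep f) a
      = rmap (rep_sum M N) a \o block_lfun \1 (h (src a)) \1)%VF.
    apply/lfunP => -[x y]; rewrite [LHS]comp_lfunE [RHS]comp_lfunE mid_rep_mapE.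
    by rewrite !shearE rep_sum_mapE linearD /= hE addrA.
  exists (@MkHom _ _ (mid_rep f) (rep_sum M N)
    (fun q => block_lfun \1 (h q) \1) ucomm).
  split; apply: hom_ext => q; [move=> x|move=> [x y]]; rewrite comp_lfunE.
    by rewrite !inl_lfunE shearE linear0 addr0.
  by rewrite shearE !snd_lfunE.
- have ucomm a : (block_lfun \1 (- h (tgt a)) \1 \o rmap (rep_sum M N) a
      = rmap (mid_rep f) a \o block_lfun \1 (- h (src a)) \1)%VF.
    apply/lfunP => -[x y]; rewrite [LHS]comp_lfunE [RHS]comp_lfunE rep_sum_mapE.
    rewrite !shearE mid_rep_mapE !opp_lfunE linearB /= hE opprD addrA.
    by rewrite addrAC subrK.
  exists (@MkHom _ _ (rep_sum M N) (mid_rep f)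
    (fun q => block_lfun \1 (- h q) \1) ucomm).
  split; apply: hom_ext => q; [move=> x|move=> [x y]]; rewrite comp_lfunE.
    by rewrite !inl_lfunE shearE linear0 addr0.
  by rewrite shearE !snd_lfunE.
Qed.

(** Such a [phi] is a retraction of the middle term onto [M]. Its block [h] from [N] to [M] exhibits
    [f] as a coboundary: compare both sides of the commutation with an arrow at [(0, y)]. *)
Lemma mid_retract (phi : rep_hom (mid_rep f) (mid_rep f)) :
  (forall q x, phi q (x, 0) = (x, 0)) -> (forall q z, (phi q z).2 = 0) ->
  pi_ext f = Ext_zero N M.
Proof.
move=> phiM phiN.
pose h q : 'Hom(N q, M q) := (fst_lfun _ _ \o (phi q \o pair_lfun 0 \1))%VF.
have phi1 q y : phi q (0, y) = (h q y, 0).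
  rewrite [LHS]surjective_pairing phiN; congr pair.
  by rewrite !comp_lfunE fst_lfunE pair_lfunE id_lfunE zero_lfunE.
apply: (@mid_split h) => a y.
have := hom_commE phi a (0, y).
rewrite phi1 !mid_rep_mapE !linear0 add0r addr0.
rewrite -[(f a y, _)](_ : (f a y, 0) + (0, rmap N a y) = _); last first.
  by congr pair; rewrite /= ?addr0 ?add0r.
by rewrite hom_addE phiM phi1 => -[].
Qed.

(** The values of [phi] lie in [M], where [phi] vanishes, so [phi = phi^2 = 0]. *)
Lemma mid_idem0 (phi : rep_hom (mid_rep f) (mid_rep f)) :
  idempotent_hom phi -> (forall q x, phi q (x, 0) = 0) ->
  (forall q z, (phi q z).2 = 0) -> forall q z, phi q z = 0.
Proof.
move=> idem phiM phiN q z.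
by rewrite -idem [phi q z]surjective_pairing phiN phiM.
Qed.

Lemma mid_indecomposable :
  indecomposable M -> indecomposable N -> pi_ext f <> Ext_zero N M ->
  (forall phi : rep_hom (mid_rep f) (mid_rep f),
     hom_comp (mid_proj f) (hom_comp phi (mid_inj f)) = hom_zero M N) ->
  indecomposable (mid_rep f).
Proof.
move=> Mind Nind nsplit theta0; apply: indecomposable_of_idempotents.
  move=> B0; case: Mind => + _; apply=> q; apply/dimv_eq0P => x.
  by have /dimv_eq0P/(_ (x, 0))[] := B0 q.
move=> phi idem.
(* The vanishing composite says exactly that [phi] maps [M] into itself, so [phi] is block upper
   triangular; [phiM] and [phiN] are its diagonal blocks. *)
have phi2 q x : (phi q (x, 0)).2 = 0.
  have := congr1 (fun h : rep_hom _ _ => h q x) (theta0 phi).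
  by rewrite !comp_lfunE /= snd_lfunE inl_lfunE zero_lfunE.
pose phiM q : 'Hom(M q, M q) := (fst_lfun _ _ \o (phi q \o pair_lfun \1 0))%VF.
pose phiN q : 'Hom(N q, N q) := (snd_lfun _ _ \o (phi q \o pair_lfun 0 \1))%VF.
have phiME q x : phi q (x, 0) = (phiM q x, 0).
  rewrite [LHS]surjective_pairing phi2; congr pair.
  by rewrite !comp_lfunE fst_lfunE pair_lfunE id_lfunE zero_lfunE.
have phiNE q z : (phi q z).2 = phiN q z.2.
  rewrite {1}(_ : z = (z.1, 0) + (0, z.2)); last first.
    by case: z => x y; congr pair; rewrite /= ?addr0 ?add0r.
  rewrite hom_addE phiME /= add0r.
  by rewrite !comp_lfunE snd_lfunE pair_lfunE id_lfunE zero_lfunE.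
have Mcomm a : (phiM (tgt a) \o rmap M a = rmap M a \o phiM (src a))%VF.
  apply/lfunP => x; rewrite [LHS]comp_lfunE [RHS]comp_lfunE.
  have := hom_commE phi a (x, 0).
  by rewrite phiME !mid_rep_mapE !linear0 !addr0 phiME => -[].
have Ncomm a : (phiN (tgt a) \o rmap N a = rmap N a \o phiN (src a))%VF.
  apply/lfunP => y; rewrite [LHS]comp_lfunE [RHS]comp_lfunE.
  (* Second components suffice: they do not see the off-diagonal block of [phi]. *)
  have := congr1 snd (hom_commE phi a (0, y)).
  by rewrite [phi _ (0, y)]surjective_pairing !mid_rep_mapE !phiNE.
have Midem : idempotent_hom (MkHom Mcomm).
  by move=> q x; have := idem q (x, 0); rewrite !phiME => -[].
have Nidem : idempotent_hom (MkHom Ncomm).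
  by move=> q y; have := congr1 snd (idem q (0, y)); rewrite !phiNE.
have [M0|M1] := indecomposable_idempotent Mind Midem;
have [N0|N1] := indecomposable_idempotent Nind Nidem.
- left; apply: mid_idem0 => // q z; first by rewrite phiME [phiM _ _]M0.
  by rewrite phiNE [phiN _ _]N0.
(* Here [phi] is 0 on [M] and induces 1 on [N], so [1 - phi] is the retraction. *)
- case: nsplit; apply: (@mid_retract (hom_compl phi)) => q z; rewrite hom_complE.
    by rewrite phiME [phiM _ _]M0 subr0.
  by rewrite /= phiNE [phiN _ _]N1 subrr.
- case: nsplit; apply: (@mid_retract phi) => q z.
    by rewrite phiME [phiM _ _]M1.
  by rewrite phiNE [phiN _ _]N0.
- right=> q z; apply/esym/eqP; rewrite -subr_eq0 -hom_complE; apply/eqP.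
  move: q z; apply: mid_idem0 => [|q x|q z]; first exact: hom_compl_idem.
    by rewrite hom_complE phiME [phiM _ _]M1 subrr.
  by rewrite hom_complE /= phiNE [phiN _ _]N1 subrr.
Qed.

End MiddleTerm.
End Representations.

Theorem theorem3p5 (k : fieldType) (Q : quiver) (M N : rep k Q)
  (e : Rsp N M) (U_NM : set (Rsp N M)) (U_M : set (Rsp M M))
  (U_N : set (Rsp N N)) (W : set (Rsp N M * Rsp M M * Rsp N N)) :
  e <> 0 ->
  strong U_M ->
  strong U_N ->
  W `<=` U_NM `*` U_M `*` U_N ->
  (forall tau lambda mu, W (tau, lambda, mu) ->
     pi_shift (e + tau) lambda mu
       <> Ext_zero (rep_shift mu) (rep_shift lambda)) ->
  (forall tau lambda mu, W (tau, lambda, mu) ->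
     forall phi : rep_hom (Brep (e + tau) lambda mu) (Brep (e + tau) lambda mu),
       Theta phi = hom_zero (rep_shift lambda) (rep_shift mu)) ->
  forall tau lambda mu, W (tau, lambda, mu) ->
    indecomposable (Brep (e + tau) lambda mu).
Proof.
move=> _ strongM strongN WU nsplit theta0 tau lambda mu Wtlm.
have [[_ /= lambdaU] /= muU] := WU _ Wtlm.
(* [Brep], [pi_shift] and [Theta] unfold to the constructions for the shifted representations;
   [e + tau] keeps its type because [Rsp] depends only on the vertex spaces. *)
apply: (@mid_indecomposable k Q (rep_shift lambda) (rep_shift mu) (e + tau)).
- exact: strongM.
- exact: strongN.
- exact: nsplit.
- exact: theta0.
Qed.
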